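(* Let $n\ge 3$ be an integer. The least positive integer $m(n)$ such that Alice can win the $m(n)/\omega$-game on every synchronizing automaton with $n$ states equals $\binom{n}{2}$.
   Context: A DFA $\mathcal{A}=(Q,\Sigma)$ consists of finite nonempty sets $Q$ (states) and $\Sigma$ (letters) with a map $Q\times\Sigma\to Q$, $(q,a)\mapsto q\cdot a$, extended to words by $q\cdot\varepsilon=q$, $q\cdot(wa)=(q\cdot w)\cdot a$, and to subsets by $P\cdot w=\{p\cdot w:p\in P\}$. A word $w$ is a reset word for $\mathcal{A}$ if $|Q\cdot w|=1$; $\mathcal{A}$ is synchronizing if it has a reset word. For a positive integer $m$, the $m/\omega$-game on $\mathcal{A}$: two players, Alice and Bob, alternate moves. On each of her turns Alice chooses a nonempty word over $\Sigma$ of length at most $m$; on each of his turns Bob chooses an arbitrary finite word in $\Sigma^*$ (possibly empty). The history of the game up to a turn is the concatenation, in order, of all words chosen so far. Alice wins if at some turn the history is a reset word for $\mathcal{A}$; Bob wins if the game continues forever. It does not matter who moves first. *)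

(* Defs.v *)
From mathcomp Require Import all_boot.
Set Implicit Arguments.
Unset Strict Implicit.
Unset Printing Implicit Defensive.

Record dfa := DFA {
  state : finType;
  letter : finType;
  step : state -> letter -> state;
  state_nonempty : 0 < #|state|;
  letter_nonempty : 0 < #|letter|
}.

Definition word (A : dfa) := seq (letter A).

Definition act (A : dfa) (q : state A) (w : word A) : state A :=
  foldl (@step A) q w.

Definition act_set (A : dfa) (P : {set state A}) (w : word A) : {set state A} :=
  [set act q w | q in P].

Definition reset_word (A : dfa) (w : word A) : Prop :=
  #|act_set [set: state A] w| = 1.

Definition synchronizing (A : dfa) : Prop := exists w : word A, reset_word w.

Inductive player := Alice | Bob.

Definition opponent (x : player) : player :=
  match x with Alice => Bob | Bob => Alice end.

(* Turns are numbered from 0. *)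
Definition mover (first : player) (k : nat) : player :=
  if odd k then opponent first else first.

(* A play lists the words chosen at turns 0, 1, 2, ...  It is infinite even
   when Alice wins: her win depends on a finite prefix only, and what is played
   after it is irrelevant. *)
Definition play (A : dfa) := nat -> word A.

Definition history (A : dfa) (p : play A) (k : nat) : word A :=
  flatten (mkseq p k).

Definition alice_wins_play (A : dfa) (p : play A) : Prop :=
  exists k, reset_word (history p k).

(* A strategy maps the list of all words chosen so far, by both players, to the
   next word; its values at lists whose length is not a turn of Alice are never
   used. *)
Definition alice_strategy (A : dfa) := seq (word A) -> word A.

Definition legal_strategy (m : nat) (A : dfa) (s : alice_strategy A) : Prop :=
  forall l, 0 < size (s l) <= m.

(* Bob's moves are unrestricted, so only Alice's turns are constrained. *)
Definition follows (first : player) (A : dfa) (s : alice_strategy A)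
    (p : play A) : Prop :=
  forall k, mover first k = Alice -> p k = s (mkseq p k).

Definition alice_can_win (first : player) (m : nat) (A : dfa) : Prop :=
  exists2 s : alice_strategy A, legal_strategy m s &
    forall p : play A, follows first s p -> alice_wins_play p.

Definition is_least_positive (P : nat -> Prop) (m : nat) : Prop :=
  [/\ 0 < m, P m & forall k, 0 < k -> P k -> m <= k].

(* Main.v *)
(* Upper bound: a shortest word merging two states visits distinct pairs before
   merging, so its length is at most 'C(n, 2), and Alice removes at least one
   state from the image at each of her turns.
   Lower bound: in the Cerny automaton (a rotation of 0, ..., n - 1, and a letter
   moving only 0, to 1) no letter lowers the distance of a pair to the diagonal by
   more than 1, the pair {1, n./2 + 1} is at distance 'C(n, 2), and Bob can reach
   it from any pair of distinct states. *)

Require Import Defs.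
From mathcomp Require Import all_boot zify.

Set Implicit Arguments.
Unset Strict Implicit.
Unset Printing Implicit Defensive.

(** * The game on an arbitrary automaton *)

Section Dfa.
Variable A : dfa.
Implicit Types (p q : state A) (w : word A) (P : {set state A}).

Lemma act_cat q w1 w2 : act q (w1 ++ w2) = act (act q w1) w2.
Proof. exact: foldl_cat. Qed.

Lemma act_set_cat P w1 w2 : act_set P (w1 ++ w2) = act_set (act_set P w1) w2.
Proof.
by rewrite /act_set -imset_comp; apply: eq_imset => q /=; rewrite act_cat.
Qed.

Lemma act_set_leq P w : #|act_set P w| <= #|P|.
Proof. exact: leq_imset_card. Qed.

Lemma act_set_ltn P w p q :
    p \in P -> q \in P -> p != q -> act p w = act q w ->
  #|act_set P w| < #|P|.
Proof.
move=> pP qP /eqP pDq eq_pq; rewrite ltn_neqAle act_set_leq andbT.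
by apply/negP => /imset_injP inj; apply: pDq; apply: inj.
Qed.

Lemma reset_word_act w p q : reset_word w -> act p w = act q w.
Proof.
move=> /eqP/cards1P[r eq_r].
have h x : act x w = r by apply/set1P; rewrite -eq_r; apply: imset_f.
by rewrite !h.
Qed.

Lemma history_rec (h : play A) k : history h k.+1 = history h k ++ h k.
Proof. by rewrite /history mkseqS -cats1 flatten_cat /= cats0. Qed.

(** Descent on the length of [w]: a word that is too long either merges at a proper prefix or
    revisits an unordered pair, and then the loop can be cut out. *)
Lemma short_merging_word p q w :
    p != q -> act p w = act q w ->
  exists w', (0 < size w' <= 'C(#|state A|, 2)) /\ act p w' = act q w'.
Proof.
move=> pDq; have [k le_k] := ubnP (size w); elim: k w le_k => // k IH w le_k eq_w.
have [le_w|gt_w] := leqP (size w) 'C(#|state A|, 2).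
  exists w; split=> //; rewrite le_w andbT lt0n size_eq0.
  by apply: contraNneq pDq => w0; move: eq_w; rewrite w0 /= => ->.
suff [w' lt_w' eq_w'] : exists2 w', size w' < size w & act p w' = act q w'.
  by apply: (IH w') => //; apply: leq_trans lt_w' _; rewrite -ltnS.
pose f (i : 'I_(size w)) := [set act p (take i w); act q (take i w)].
have [/existsP[i /eqP eq_i]|/existsPn neq] :=
    boolP [exists i : 'I_(size w), act p (take i w) == act q (take i w)].
  by exists (take i w) => //; rewrite size_takel // ltnW.
have [inj|/injectivePn[i [j iDj eq_f]]] := boolP (injectiveb f).
  suff : size w <= 'C(#|state A|, 2) by rewrite leqNgt gt_w.
  rewrite -card_draws -[X in X <= _]card_ord -(card_imset _ (injectiveP _ inj)).
  apply/subset_leq_card/subsetP => _ /imsetP[i _ ->].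
  by rewrite inE cards2 neq.
have {i j iDj eq_f} [i [j [lt_ij eq_f]]] :
    exists i j : 'I_(size w), i < j /\ f i = f j.
  by move: iDj; rewrite neq_ltn => /orP[]; [exists i, j | exists j, i].
exists (take i w ++ drop j w).
  rewrite size_cat size_drop (size_takel (ltnW (ltn_ord i))).
  by rewrite -[ltnRHS](subnKC (ltnW (ltn_ord j))) ltn_add2r.
have : act p (take i w) \in f j by rewrite -eq_f set21.
have : act q (take i w) \in f j by rewrite -eq_f set22.
(* The two visits may list the pair in opposite orders, but [drop j w] merges it either way. *)
rewrite !act_cat => /set2P[] -> /set2P[] ->;
  by rewrite // -!act_cat cat_take_drop.
Qed.

(** The implication lets the statement hold for every [P], so that [xchoose] yields a legal word
    after any history, even once the image is a singleton. *)
Lemma shrinking_word P : synchronizing A -> 1 < #|state A| ->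
  exists w : word A, (0 < size w <= 'C(#|state A|, 2)) &&
     ((1 < #|P|) ==> (#|act_set P w| < #|P|)).
Proof.
move=> [w rw] cA.
have [/card_gt1P[p [q [pP qP pDq]]]|leP] := ltnP 1 #|P|.
  have [w' [sz eq_w']] := short_merging_word pDq (reset_word_act p q rw).
  by exists w'; rewrite sz; apply: act_set_ltn eq_w'.
have /card_gt0P[a _] := letter_nonempty A.
by exists [:: a]; rewrite andbT /= bin_gt0.
Qed.

Lemma alice_can_win_bin2 first : synchronizing A -> 1 < #|state A| ->
  alice_can_win first 'C(#|state A|, 2) A.
Proof.
move=> sA cA.
pose Q l : {set state A} := act_set setT (flatten l).
pose s : alice_strategy A := fun l => xchoose (shrinking_word (Q l) sA cA).
exists s => [l|h hP]; first by have /andP[] := xchooseP (shrinking_word (Q l) sA cA).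
pose c k := #|act_set [set: state A] (history h k)|.
have c_le k : c k.+1 <= c k by rewrite /c history_rec act_set_cat act_set_leq.
have c_lt k : mover first k = Alice -> 1 < c k -> c k.+1 < c k.
  move=> /hP eq_h gt_c; rewrite /c history_rec act_set_cat eq_h.
  by have /andP[_ /implyP] := xchooseP (shrinking_word (Q (mkseq h k)) sA cA); apply.
(* Whoever moves first, exactly one of these two turns is Alice's; [maxn 1] covers images that are
   already singletons. *)
have c_lt2 k : c k.+1.*2 <= maxn 1 (c k.*2).-1.
  have := c_le k.*2; have := c_le k.*2.+1; have := c_lt k.*2; have := c_lt k.*2.+1.
  rewrite doubleS /mover /= odd_double /=.
  by case: (first) => /= h1 h2; [have := h2 erefl | have := h1 erefl]; lia.
have c_bound k : c k.*2 <= 1 + (#|state A| - k).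
  elim: k => [|k IH]; last by have := c_lt2 k; lia.
  by rewrite subn0; apply: leq_trans (act_set_leq _ _) _; rewrite cardsT; lia.
exists (#|state A|).*2; apply/eqP; rewrite eqn_leq.
apply/andP; split; first by have := c_bound #|state A|; rewrite subnn.
have /card_gt0P[q _] := state_nonempty A.
by apply/card_gt0P; exists (act q (history h (#|state A|).*2)); apply: imset_f.
Qed.

(* Bob keeps the images of [p0] and [q0] apart: one turn of Alice cannot bring
   their potential below [N], so they stay distinct and Bob raises it again. *)
Lemma potential_not_alice_can_win (F : state A -> state A -> nat)
    (raise : state A -> state A -> word A) N m first p0 q0 :
    (forall p, F p p < N) ->
    (forall p q c, F p q <= (F (step p c) (step q c)).+1) ->
    N + m <= F p0 q0 ->
    (forall p q, p != q ->
      N + m <= F (act p (raise p q)) (act q (raise p q))) ->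
  ~ alice_can_win first m A.
Proof.
move=> Fdiag Fstep F0 Fraise [s s_legal s_wins].
have Fact p q w : F p q <= F (act p w) (act q w) + size w.
  elim: w p q => [|c w IH] p q /=; first by rewrite addn0.
  by have := Fstep p q c; have := IH (step p c) (step q c); lia.
pose bob (l : seq (word A)) : word A :=
  raise (act p0 (flatten l)) (act q0 (flatten l)).
pose turn l := if mover first (size l) is Alice then s l else bob l.
(* Each move depends on all earlier ones, so the play of [s] against [bob] is built through its
   lists of past words. *)
pose l := fix l k := if k is k'.+1 then rcons (l k') (turn (l k')) else [::].
pose h : play A := fun k => turn (l k).
have size_l k : size (l k) = k by elim: k => //= k IH; rewrite size_rcons IH.
have mkseq_h k : mkseq h k = l k by elim: k => // k IH; rewrite mkseqS IH.
have h_follows : follows first s h.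
  by move=> k; rewrite mkseq_h /h /turn size_l => ->.
have [k rk] := s_wins h h_follows.
(* The slack [m] is what Alice can use up in one turn; on Bob's turn [N] suffices, as it rules out
   equal images. *)
have inv j : N + (if mover first j is Alice then m else 0) <=
    F (act p0 (history h j)) (act q0 (history h j)).
  elim: j => [|j IH]; first by case: mover => //=; apply: leq_trans F0; lia.
  rewrite history_rec !act_cat; move: IH.
  set p := act p0 _; set q := act q0 _.
  have -> : mover first j.+1 = opponent (mover first j).
    by rewrite /mover /=; case: odd => //=; case: (first).
  rewrite {1}/h /turn size_l; case eq_m: (mover first j) => /= leF.
    by have := Fact p q (h j); have /andP[_] := s_legal (l j);
       rewrite /h /turn size_l eq_m; lia.
  rewrite /h /turn size_l eq_m /bob -mkseq_h -/(history h j).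
  apply: Fraise; apply: contraTneq leF => eq_pq.
  by rewrite eq_pq addn0 -ltnNge Fdiag.
have := inv k; rewrite (reset_word_act p0 q0 rk).
by have := Fdiag (act q0 (history h k)); lia.
Qed.
End Dfa.

(** * The Cerny automaton and its potential on pairs *)

Section Cerny.
Variable n : nat.
Hypothesis n_gt2 : 2 < n.

Definition cerny_step (q : 'I_n) (rotate : bool) : 'I_n :=
  if rotate || (val q == 0) then ordS q else q.

Fact card_ord_gt0 : 0 < #|'I_n|.
Proof. by rewrite card_ord; lia. Qed.

Fact card_bool_gt0 : 0 < #|{: bool}|.
Proof. by rewrite card_bool. Qed.

Definition cerny : dfa := DFA cerny_step card_ord_gt0 card_bool_gt0.

Lemma val_ordS (q : 'I_n) : val (ordS q) = if q.+1 == n then 0 else q.+1.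
Proof.
rewrite /=; case: eqP => [->|neq]; first by rewrite modnn.
by rewrite modn_small //; have := ltn_ord q; lia.
Qed.

Lemma val_cerny_step (q : 'I_n) c : val (cerny_step q c) =
  if c || (val q == 0) then if q.+1 == n then 0 else q.+1 else q.
Proof. by rewrite /cerny_step; case: ifP => // _; rewrite val_ordS. Qed.

(* Shortest merging words for a pair rotate until [p] is at 0, then lower the
   gap from [p] to [q] by 1, which leaves [p] at 1, hence [n] letters per unit
   of gap. For distinct states the distance to the diagonal is the minimum over
   the two orders of the pair, minus [n.-1]. *)
Definition gap (p q : nat) : nat := if p <= q then q - p else n + q - p.

Definition turns_to_0 (p : nat) : nat := if p == 0 then 0 else n - p.

Definition ordered_potential (p q : nat) : nat := n * gap p q + turns_to_0 p.

Definition cerny_potential (p q : nat) : nat :=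
  minn (ordered_potential p q) (ordered_potential q p).

Lemma cerny_potential_diag (q : 'I_n) : cerny_potential q q < n.
Proof.
rewrite /cerny_potential minnn /ordered_potential /gap leqnn subnn muln0 add0n.
by rewrite /turns_to_0; case: eqP; lia.
Qed.

(** Lowering the gap by 1 loses [n], which is compensated when [turns_to_0] jumps from 0 to [n.-1]
    as 0 moves to 1. *)
Lemma leq_ordered_potential p q p' q' :
    gap p q <= gap p' q' /\ turns_to_0 p <= (turns_to_0 p').+1 \/
    gap p q <= (gap p' q').+1 /\ turns_to_0 p + n <= (turns_to_0 p').+1 ->
  ordered_potential p q <= (ordered_potential p' q').+1.
Proof. by rewrite /ordered_potential => -[] []; nia. Qed.

Lemma ordered_potential_step (p q : 'I_n) c :
  cerny_potential p q <= (ordered_potential (cerny_step p c) (cerny_step q c)).+1.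
Proof.
rewrite geq_min !val_cerny_step.
have /= := ltn_ord p; have /= := ltn_ord q.
move: (nat_of_ord p) (nat_of_ord q) => x y lty ltx.
have [/andP[/negbTE-> /andP[/eqP-> x_gt0]]|] := boolP (~~ c && ((y == 0) && (0 < x))).
  rewrite eqxx /= [x == 0]eqn0Ngt x_gt0 /=.
  have -> : (1 == n) = false by lia.
  (* Here [q] alone moves, from 0 to 1. This widens the gap from [p], unless [x = 1] and the pair
     merges; then the order from 0 to 1, of gap 1, bounds the minimum. *)
  apply/orP; have [->|xn1] := eqVneq x 1; [right | left];
    apply: leq_ordered_potential; rewrite /gap /turns_to_0 /=;
    repeat case: ifP => ?; lia.
move=> not_y0; apply/orP; left; apply: leq_ordered_potential; move: not_y0.
by case: c => /=; repeat case: ifP => ?; rewrite /gap /turns_to_0 /=;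
  repeat case: ifP => ?; lia.
Qed.

Lemma cerny_potentialC p q : cerny_potential p q = cerny_potential q p.
Proof. exact: minnC. Qed.

Lemma cerny_potential_step (p q : 'I_n) c :
  cerny_potential p q <=
    (cerny_potential (cerny_step p c) (cerny_step q c)).+1.
Proof.
rewrite [X in _ <= X.+1]/cerny_potential -minnSS leq_min ordered_potential_step.
by rewrite cerny_potentialC ordered_potential_step.
Qed.

(** * Rotations, truncated predecessors and Bob's words *)

Definition rotate_word k : word cerny := nseq k true.

Lemma act_rotate (q : state cerny) k :
  val (act q (rotate_word k)) = (val q + k) %% n.
Proof.
elim: k q => [|k IH] q /=; first by rewrite addn0 modn_small ?ltn_ord.
by rewrite IH /= modnDml addSnnS.
Qed.

(* The letter fixing all but 0, then the inverse rotation: the truncated predecessor. *)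
Definition pred_word : word cerny := false :: rotate_word n.-1.

Lemma act_pred (q : state cerny) : val (act q pred_word) = (val q).-1.
Proof.
rewrite [act _ _]/= -/(rotate_word _) -/(act _ _) act_rotate val_cerny_step.
have /= := ltn_ord q; case: eqP => [->|] /= ltq; last first.
  by move=> ?; rewrite (_ : _ + _ = q.-1 + n) ?modnDr ?modn_small; lia.
by case: eqP => [|_]; [lia | rewrite add1n prednK ?modnn; lia].
Qed.

Definition pred_words k : word cerny := flatten (nseq k pred_word).

Lemma act_pred_words (q : state cerny) k :
  val (act q (pred_words k)) = val q - k.
Proof.
elim: k q => [|k IH] q; first by rewrite subn0.
by rewrite /pred_words /= act_cat IH act_pred -subn1 -subnDA.
Qed.

Lemma cerny_synchronizing : synchronizing cerny.
Proof.
exists (pred_words n); apply/eqP/cards1P.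
have n_gt0 : 0 < n by lia.
exists (Ordinal n_gt0); apply/setP => q; rewrite inE.
apply/imsetP/eqP => [[x _ ->]|->].
  by apply: val_inj; rewrite act_pred_words /=; have := ltn_ord x; lia.
exists (Ordinal n_gt0) => //; apply: val_inj.
by rewrite act_pred_words.
Qed.

(* Truncated predecessors bring the pair to [{0, d}]. If [d] is too small, rotate
   it to [{n - d, 0}]; further predecessors then give [{0, n./2}]. *)
Definition raise_ltn (p q : state cerny) : word cerny :=
  let d := val q - val p in
  pred_words (val p) ++
  (if n./2 <= d then pred_words (d - n./2)
   else rotate_word (n - d) ++ pred_words (n - d - n./2)) ++
  rotate_word 1.

(** The closing rotation puts one state at 1, where [turns_to_0] is largest. *)
Lemma raise_ltn_potential (p q : state cerny) : val p < val q ->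
  cerny_potential (val (act p (raise_ltn p q))) (val (act q (raise_ltn p q))) =
  cerny_potential 1 n./2.+1.
Proof.
have := odd_double_half n => eq_n.
rewrite /raise_ltn !act_cat !act_rotate => ltpq.
have /= := ltn_ord p; have /= := ltn_ord q => ltq ltp.
case: leqP => led; rewrite ?act_cat !act_pred_words ?act_rotate ?act_pred_words.
  rewrite /= in ltpq led *.
  have -> : (p - p - (q - p - n./2) + 1) %% n = 1 by rewrite modn_small; lia.
  have -> // : (q - p - (q - p - n./2) + 1) %% n = n./2.+1.
  by rewrite modn_small; lia.
rewrite /= in ltpq led *.
rewrite subnn add0n [(n - _) %% n]modn_small ?subnKC ?modnn; try lia.
have -> : (0 - (n - (q - p) - n./2) + 1) %% n = 1 by rewrite modn_small; lia.
have -> : (n - (q - p) - (n - (q - p) - n./2) + 1) %% n = n./2.+1.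
  by rewrite modn_small; lia.
(* In this branch the two states have exchanged roles. *)
exact: cerny_potentialC.
Qed.

Definition raise (p q : state cerny) : word cerny :=
  if val p < val q then raise_ltn p q else raise_ltn q p.

Lemma raise_potential (p q : state cerny) : p != q ->
  cerny_potential (val (act p (raise p q))) (val (act q (raise p q))) =
  cerny_potential 1 n./2.+1.
Proof.
rewrite /raise neq_ltn => /orP[ltpq|ltqp].
  by rewrite ltpq raise_ltn_potential.
by rewrite ltnNge ltnW // cerny_potentialC -[RHS](raise_ltn_potential ltqp).
Qed.

(** For odd [n] the minimum is attained by the order starting at 1; for even [n] both gaps are
    [n./2] and the other order attains it. *)
Lemma cerny_potential_top :
  n.-1 + 'C(n, 2) <= cerny_potential 1 n./2.+1.
Proof.
have eq_n := odd_double_half n.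
(* Thus ['C(n, 2)] is [n * n./2] for odd [n], and [n./2] less for even [n]. *)
have eq_C : 'C(n, 2) + ~~ odd n * n./2 = n * n./2.
  rewrite bin2; move: eq_n; case: (odd n) => /= eq_n.
    have -> : n.-1 = n./2.*2 by lia.
    by rewrite -doubleMr doubleK addn0.
  have -> : n * n.-1 = (n./2 * n.-1).*2 by rewrite doubleMl; congr (_ * _); lia.
  by rewrite doubleK mul1n -mulnSr prednK 1?mulnC //; lia.
rewrite leq_min /ordered_potential /gap /turns_to_0.
have -> : (1 <= n./2.+1) = true by lia.
have -> : (n./2.+1 <= 1) = false by lia.
have -> : n + 1 - n./2.+1 = n./2 + odd n by lia.
rewrite mulnDr -eq_C /=; case: (odd n) eq_n => /=; lia.
Qed.

Lemma cerny_not_alice_can_win first m : m < 'C(n, 2) ->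
  ~ alice_can_win first m cerny.
Proof.
move=> lt_m.
(* Diagonal potentials reach [n.-1], so the threshold is [n]; the strict bound on [m] absorbs the
   extra 1. *)
have le_top : n + m <= cerny_potential 1 n./2.+1.
  by apply: leq_trans cerny_potential_top; lia.
have lt1 : 1 < n by lia.
have lth : n./2.+1 < n by have := odd_double_half n; lia.
apply: (@potential_not_alice_can_win cerny
  (fun p q => cerny_potential (val p) (val q)) raise n m first
  (Ordinal lt1) (Ordinal lth)) => //.
- exact: cerny_potential_diag.
- exact: cerny_potential_step.
- by move=> p q /raise_potential ->.
Qed.
End Cerny.

Theorem proposition5p4 (n : nat) (hn : 3 <= n) (first : player) :
  is_least_positive
    (fun m => forall A : dfa,
       #|state A| = n -> synchronizing A -> alice_can_win first m A)
    'C(n, 2).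
Proof.
split=> [|A cA sA|k _ wins].
- by rewrite bin_gt0 ltnW.
- by rewrite -cA; apply: alice_can_win_bin2; rewrite // cA ltnW.
- rewrite leqNgt; apply/negP => lt_k.
  case: (@cerny_not_alice_can_win n hn first k lt_k).
  by apply: wins; [exact: card_ord | exact: cerny_synchronizing].
Qed.
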